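(* For every integer $t\ge 0$ and every $\varepsilon>0$ there exist $\delta\in(0,\varepsilon)$ and $N>0$ such that for every $n>N$ the following holds. Let $H$ be an $F_5^{t}$-free $3$-graph on vertex set $[n]$ with at least $(\frac{1}{27}-\delta)n^3$ hyperedges, and let $\pi=(V_1,V_2,V_3)$ be a partition of $[n]$ maximizing $|H_\pi|$. Then $|H\setminus H_\pi|\le \varepsilon n^3$.
   Context: A $3$-graph is a $3$-uniform hypergraph, identified with its set of hyperedges. For an integer $t\ge 0$, $F_5^{t}$ is the $3$-graph on vertex set $\{1,\dots,5+t\}$ with hyperedges $\{1,2,3\},\{1,2,4\}$ and $\{3,4,k\}$ for $5\le k\le 5+t$; $H$ is $F_5^t$-free if it contains no copy of $F_5^t$ as a subhypergraph. For a partition $\pi=(V_1,V_2,V_3)$ of $[n]$, $K_\pi$ is the set of triples with exactly one vertex in each $V_i$, and $H_\pi=H\cap K_\pi$. *)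

(* Defs.v *)
From mathcomp Require Import all_boot all_order all_algebra.
From mathcomp Require Import reals.

Set Implicit Arguments.
Unset Strict Implicit.
Unset Printing Implicit Defensive.

(* A hypergraph on the vertex type T is its set of hyperedges, {set {set T}}. *)
Definition three_graph (T : finType) (H : {set {set T}}) : Prop :=
  forall e : {set T}, e \in H -> #|e| = 3.

(* Not necessarily induced copy: an injection of vertices sending each hyperedge
   of F to a hyperedge of H. *)
Definition contains_copy (S T : finType) (F : {set {set S}}) (H : {set {set T}})
  : Prop :=
  exists f : S -> T, injective f /\
    forall e : {set S}, e \in F -> f @: e \in H.

Definition is_free (S T : finType) (F : {set {set S}}) (H : {set {set T}})
  : Prop := ~ contains_copy F H.

(* Vertex i of the usual labelling 1, ..., 5 + t is the ordinal i - 1 here. *)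
Definition F5 (t : nat) : {set {set 'I_(5 + t)}} :=
  let v (i : nat) : 'I_(5 + t) := @inord (4 + t) i in
  [set [set v 0; v 1; v 2]; [set v 0; v 1; v 3]]
  :|: [set [set v 2; v 3; k] | k : 'I_(5 + t) & 4 <= k].

(* Labelled parts V 0, V 1, V 2.  Unlike in finset's [partition], a part may be
   empty. *)
Definition tripartition (T : finType) (V : 'I_3 -> {set T}) : Prop :=
  (forall i j : 'I_3, i != j -> [disjoint V i & V j]) /\
  \bigcup_(i < 3) V i = [set: T].

Definition Kpart (T : finType) (V : 'I_3 -> {set T}) : {set {set T}} :=
  [set e : {set T} | (#|e| == 3) && [forall i : 'I_3, #|e :&: V i| == 1]].

Definition Hpart (T : finType) (H : {set {set T}}) (V : 'I_3 -> {set T})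
  : {set {set T}} := H :&: Kpart V.

Definition max_tripartition (T : finType) (H : {set {set T}})
    (V : 'I_3 -> {set T}) : Prop :=
  tripartition V /\
  forall W : 'I_3 -> {set T}, tripartition W -> #|Hpart H W| <= #|Hpart H V|.

(* Main.v *)
Require Import Defs.
From mathcomp Require Import all_boot all_order all_algebra.
From mathcomp Require Import reals.
From mathcomp Require Import zify lra.
(* Call a pair heavy if its codegree is more than t + 2, and keep only the
   hyperedges all of whose pairs are heavy; this loses O(n^2) hyperedges.  If
   pqx, pqy are hyperedges then xy is not heavy, or else there would be a copy
   of F_5^t, so the 3-graph kept is cancellative.  In a cancellative 3-graph,
   delete vertices of low degree until the minimum degree is just below n^2/9.
   The links of vertices that are pairwise covered by hyperedges are disjoint
   and have a K_6-free union when there are four of them, which is impossible at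
   this degree: the shadow P is K_4-free.  The codegree neighbourhoods of the
   pairs of a hyperedge are disjoint too, whence 9|H| <= n|P| by Cauchy-Schwarz,
   so that P has almost n^2/3 edges.  By Füredi's stability argument the shadow
   has a 3-colouring with few monochromatic pairs, and every non-crossing
   hyperedge contains such a pair. *)

Set Implicit Arguments.
Unset Strict Implicit.
Unset Printing Implicit Defensive.

(** * Stability of K_{r+2}-free graphs *)

(** After multiplication by r + 1 the two sides differ by at least the square of b - (r + 1)c. *)
Lemma turan_step r b c X Y : r.+1 * X <= r * b ^ 2 -> Y <= c * b ->
  r.+2 * (X + 2 * Y) <= r.+1 * (b + c) ^ 2.
Proof.
move=> hX hY; rewrite -(leq_pmul2l (ltn0Sn r)).
have [+ _] := nat_Cauchy b (r.+1 * c).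
have : r.+2 * (r.+1 * X) <= r.+2 * (r * b ^ 2) by rewrite leq_mul2l hX orbT.
have : r.+1 * r.+2 * Y <= r.+1 * r.+2 * (c * b) by rewrite leq_mul2l hY orbT.
rewrite !expnS !expn0; lia.
Qed.

(* Füredi's argument: colour the non-neighbours of a vertex of maximum degree
   with a new colour and recurse into its neighbourhood. *)
Lemma furedi_stability (T : finType) (E : rel T) r (A : {set T}) :
  symmetric E ->
  (forall s : seq T, size s = r.+2 -> all (mem A) s -> ~~ pairwise E s) ->
  exists f : T -> 'I_r.+1,
    r.+1 * (\sum_(u in A) \sum_(v in A) (E u v + (E u v && (f u == f v))))
      <= r * #|A| ^ 2.
Proof.
move=> symE; elim: r A => [|r IH] A noK.
  exists (fun=> ord0); rewrite big1 // => u uA; rewrite big1 // => v vA.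
  suff -> : E u v = false by [].
  by have := noK [:: u; v] erefl; rewrite /= uA vA !andbT => /(_ isT)/negbTE.
have [->|[x0 x0A]] := set_0Vmem A.
  by exists (fun=> ord0); rewrite big_set0 muln0.
have [x xA xmax] := arg_maxnP (fun x => \sum_(v in A) E x v) x0A.
pose B := A :&: [set v | E x v]; pose C := A :\: [set v | E x v].
have [|f hf] := IH B.
  move=> s hs sB; have sub : all (mem A) (x :: s).
    by apply/andP; split=> //; apply: sub_all sB => v /setIP[].
  have := noK (x :: s); rewrite sub /= hs => /(_ erefl isT).
  have -> : all (E x) s by apply: sub_all sB => v /setIP[_]; rewrite inE.
  by [].
exists (fun u => if E x u then lift ord0 (f u) else ord0).
have hA : #|A| = #|B| + #|C| by rewrite cardsID.
have splitA (F : T -> nat) :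
    \sum_(v in A) F v = \sum_(v in B) F v + \sum_(v in C) F v.
  exact: big_setID.
have hB u : u \in B -> E x u by case/setIP=> _; rewrite inE.
have hC u : u \in C -> E x u = false by case/setDP=> _; rewrite inE => /negbTE.
have degx : \sum_(v in A) E x v = #|B|.
  rewrite splitA [X in _ + X]big1 ?addn0 => [|v /hC-> //].
  by rewrite -sum1_card; apply: eq_bigr => v /hB->.
pose Y := \sum_(u in C) \sum_(v in A) E u v.
have hY : Y <= #|C| * #|B|.
  rewrite -sum_nat_const; apply: leq_sum => u /setDP[uA _].
  by rewrite -degx; apply: xmax.
(* Edges between [B] and [C] are never monochromatic but occur in both orders; edges inside [C] are
   all monochromatic and weigh 2. Together this gives 2Y. *)
suff -> : \sum_(u in A) \sum_(v in A) (E u v + (E u v &&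
     ((if E x u then lift ord0 (f u) else ord0) ==
      (if E x v then lift ord0 (f v) else ord0)))) =
   \sum_(u in B) \sum_(v in B) (E u v + (E u v && (f u == f v))) + 2 * Y.
  by rewrite hA; exact: turan_step.
have -> : Y = \sum_(u in C) \sum_(v in B) E u v + \sum_(u in C) \sum_(v in C) E u v.
  by rewrite -big_split; apply: eq_bigr => u _; rewrite splitA.
rewrite splitA (eq_bigr _ (fun u _ => splitA _)) big_split /=.
rewrite [X in _ + X](eq_bigr _ (fun u _ => splitA _)) big_split /=.
have -> : \sum_(u in B) \sum_(v in C) (E u v + (E u v &&
     ((if E x u then lift ord0 (f u) else ord0) ==
      (if E x v then lift ord0 (f v) else ord0)))) =
    \sum_(u in C) \sum_(v in B) E u v.
  rewrite exchange_big; apply: eq_bigr => v vC; apply: eq_bigr => u uB.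
  by rewrite (hB u uB) (hC v vC) eq_sym (negbTE (neq_lift _ _)) andbF addn0 symE.
have -> : \sum_(u in C) \sum_(v in B) (E u v + (E u v &&
     ((if E x u then lift ord0 (f u) else ord0) ==
      (if E x v then lift ord0 (f v) else ord0)))) =
    \sum_(u in C) \sum_(v in B) E u v.
  apply: eq_bigr => u uC; apply: eq_bigr => v vB.
  by rewrite (hC u uC) (hB v vB) (negbTE (neq_lift _ _)) andbF addn0.
have -> : \sum_(u in C) \sum_(v in C) (E u v + (E u v &&
     ((if E x u then lift ord0 (f u) else ord0) ==
      (if E x v then lift ord0 (f v) else ord0)))) =
    2 * \sum_(u in C) \sum_(v in C) E u v.
  rewrite big_distrr; apply: eq_bigr => u uC; rewrite big_distrr.
  by apply: eq_bigr => v vC; rewrite (hC u uC) (hC v vC) eqxx andbT; case: (E u v).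
have -> : \sum_(u in B) \sum_(v in B) (E u v + (E u v &&
     ((if E x u then lift ord0 (f u) else ord0) ==
      (if E x v then lift ord0 (f v) else ord0)))) =
    \sum_(u in B) \sum_(v in B) (E u v + (E u v && (f u == f v))).
  apply: eq_bigr => u uB; apply: eq_bigr => v vB.
  by rewrite (hB u uB) (hB v vB) (inj_eq lift_inj).
lia.
Qed.

(** * Cancellative 3-graphs as ternary relations *)

Section Triples.
Variable T : finType.
Implicit Types (e : T -> T -> T -> bool) (S : {set T}).

(* A 3-graph is encoded by its symmetric ternary relation, and counts run over
   ordered tuples: size3 is 6|H|, deg is twice the degree. *)
Definition triple_sym e :=
  (forall x y z, e x y z = e y x z) /\ (forall x y z, e x y z = e x z y).

(* As w may coincide with p or q, this excludes K_4^- as well as F_5. *)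
Definition cancellative e :=
  forall p q x y w, e p q x -> e p q y -> e x y w -> False.

Definition restr e S x y z := [&& x \in S, y \in S, z \in S & e x y z].
Definition codeg e x y := \sum_z e x y z.
Definition deg e x := \sum_y codeg e x y.
Definition size3 e := \sum_x deg e x.
Definition shadow e x y := [exists z, e x y z].

Lemma triple_sum_fst (F : T -> T -> nat) e : triple_sym e ->
  \sum_x \sum_y \sum_z e x y z * F y z = \sum_x \sum_y \sum_z e x y z * F x y.
Proof.
move=> [s1 s2]; rewrite exchange_big; apply: eq_bigr => x _.
rewrite exchange_big; apply: eq_bigr => y _; apply: eq_bigr => z _.
by rewrite s1 s2.
Qed.

Lemma triple_sum_mid (F : T -> T -> nat) e : triple_sym e ->
  \sum_x \sum_y \sum_z e x y z * F x z = \sum_x \sum_y \sum_z e x y z * F x y.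
Proof.
move=> [_ s2]; apply: eq_bigr => x _; rewrite exchange_big.
by apply: eq_bigr => y _; apply: eq_bigr => z _; rewrite s2.
Qed.

Lemma triple_sum_pair (F : T -> T -> nat) e :
  \sum_x \sum_y \sum_z e x y z * F x y = \sum_x \sum_y codeg e x y * F x y.
Proof. by do 2![apply: eq_bigr => ? _]; rewrite -big_distrl. Qed.

(** By symmetry the three pairs of places contribute equally. [F] will be the codegree, or the
    indicator of monochromatic or of light pairs. *)
Lemma triple_sum_pairs (F : T -> T -> nat) e : triple_sym e ->
  \sum_x \sum_y \sum_z e x y z * (F x y + F x z + F y z) =
  3 * \sum_x \sum_y codeg e x y * F x y.
Proof.
move=> se; rewrite -triple_sum_pair.
rewrite mulSn mulSn mul1n -{2}(triple_sum_mid F se) -{2}(triple_sum_fst F se).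
rewrite -!big_split; apply: eq_bigr => x _; rewrite -!big_split.
apply: eq_bigr => y _; rewrite -!big_split.
by apply: eq_bigr => z _ /=; rewrite !mulnDr addnA.
Qed.

Lemma triple_sum_vtx (F : T -> nat) e : triple_sym e ->
  \sum_x \sum_y \sum_z e x y z * (F x + F y + F z) = 3 * \sum_x deg e x * F x.
Proof.
move=> se; have [s1 s2] := se.
have h1 : \sum_x \sum_y \sum_z e x y z * F x = \sum_x deg e x * F x.
  apply: eq_bigr => x _; rewrite big_distrl; apply: eq_bigr => y _.
  by rewrite -big_distrl.
have h2 : \sum_x \sum_y \sum_z e x y z * F y = \sum_x deg e x * F x.
  rewrite -h1 exchange_big; apply: eq_bigr => x _; apply: eq_bigr => y _.
  by apply: eq_bigr => z _; rewrite s1.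
have h3 : \sum_x \sum_y \sum_z e x y z * F z = \sum_x deg e x * F x.
  by rewrite -h2 (triple_sum_fst (fun _ z => F z) se).
rewrite mulSn mulSn mul1n -{1}h1 -{1}h2 -{1}h3 -!big_split.
apply: eq_bigr => x _; rewrite -!big_split.
apply: eq_bigr => y _; rewrite -!big_split.
by apply: eq_bigr => z _ /=; rewrite !mulnDr addnA.
Qed.

Lemma triple_sym_perm e x y z : triple_sym e -> e x y z -> e x z y /\ e y z x.
Proof. by move=> [s1 s2] h; split; [rewrite s2 | rewrite s2 s1]. Qed.

Lemma leq_size3 e e' : (forall x y z, e x y z <= e' x y z) -> size3 e <= size3 e'.
Proof. by move=> h; do 3![apply: leq_sum => ? _]. Qed.

Lemma restr_sym e S : triple_sym e -> triple_sym (restr e S).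
Proof.
by case=> s1 s2; split=> x y z; rewrite /restr; [rewrite s1 | rewrite s2];
  case: (x \in S); case: (y \in S); case: (z \in S).
Qed.

Lemma restr_cancellative e S : cancellative e -> cancellative (restr e S).
Proof.
move=> ce p q x y w /and4P[_ _ _ h1] /and4P[_ _ _ h2] /and4P[_ _ _ h3].
exact: ce h1 h2 h3.
Qed.

Lemma shadow_sym e : triple_sym e -> symmetric (shadow e).
Proof. by case=> s1 _ x y; apply: eq_existsb => z; rewrite s1. Qed.

(* 3m^2 <= phi m - phi (m - 1) for phi m = m^3 + 3m^2, so phi accounts for the
   successive deletion of low-degree vertices. *)
Lemma phi_step m : 3 * m.+1 ^ 2 + (m ^ 3 + 3 * m ^ 2) <= m.+1 ^ 3 + 3 * m.+1 ^ 2.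
Proof. rewrite !expnS !expn0; lia. Qed.

(* For deg, which counts ordered pairs, 4/19 lies between 1/5, where
   shadow_K4_free applies, and 2/9, the density of the extremal 3-graph. *)
Lemma delete_low_degree e : triple_sym e ->
  exists S : {set T},
    (forall x, x \in S -> 4 * #|S| ^ 2 <= 19 * deg (restr e S) x) /\
    19 * size3 e + 4 * (#|S| ^ 3 + 3 * #|S| ^ 2) <=
      19 * size3 (restr e S) + 4 * (#|T| ^ 3 + 3 * #|T| ^ 2).
Proof.
move=> se.
suff H : forall S : {set T}, exists S' : {set T},
    (forall x, x \in S' -> 4 * #|S'| ^ 2 <= 19 * deg (restr e S') x) /\
    19 * size3 (restr e S) + 4 * (#|S'| ^ 3 + 3 * #|S'| ^ 2) <=
      19 * size3 (restr e S') + 4 * (#|S| ^ 3 + 3 * #|S| ^ 2).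
  have [S' [h1 h2]] := H setT; exists S'; split=> //.
  have -> : size3 e = size3 (restr e setT).
    by do 3![apply: eq_bigr => ? _]; rewrite /restr !inE.
  by rewrite -cardsT.
move=> S; have [m] := ubnP #|S|; elim: m S => // m IH S hm.
have [/forall_inP hS|] := boolP [forall x in S, 4 * #|S| ^ 2 <= 19 * deg (restr e S) x].
  by exists S.
rewrite negb_forall_in => /exists_inP[x xS]; rewrite -ltnNge => hx.
have hc : #|S| = #|S :\ x|.+1 by rewrite (cardsD1 x) xS.
have [|S' [h1 h2]] := IH (S :\ x); first by lia.
exists S'; split=> //.
(* A lost triple has [x] in one of its three places; [triple_sum_vtx] with the indicator of [x]
   counts these. *)
have : size3 (restr e S) <= size3 (restr e (S :\ x)) + 3 * deg (restr e S) x.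
  have -> : deg (restr e S) x = \sum_y deg (restr e S) y * (y == x).
    rewrite (bigD1 x) //= eqxx muln1 big1 ?addn0 // => y /negbTE->.
    by rewrite muln0.
  rewrite -(triple_sum_vtx _ (restr_sym S se)) -big_split.
  apply: leq_sum => u _; rewrite -big_split; apply: leq_sum => v _.
  rewrite -big_split; apply: leq_sum => w _; rewrite /restr !inE.
  by case: (u == x); case: (v == x); case: (w == x);
    case: (u \in S); case: (v \in S); case: (w \in S); case: (e u v w).
have := phi_step #|S :\ x|; rewrite -hc; lia.
Qed.

(* The links of pairwise covered vertices a, b, c, d are disjoint.  At a vertex
   of a K_6 in their union, two of the five edges lie in the same link, and then
   their ends are covered, against cancellativity: so the union is K_6-free,
   hence too small for four links of large degree. *)
Lemma shadow_K4_free e S : triple_sym e -> cancellative e ->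
  (forall x, x \in S -> 4 * #|S| ^ 2 <= 19 * deg (restr e S) x) ->
  forall s : seq T, size s = 4 -> all (mem S) s ->
    ~~ pairwise (shadow (restr e S)) s.
Proof.
move=> se0 ce0 hdeg s s4 sS; apply/negP => ps.
have := restr_cancellative (S := S) ce0.
have := restr_sym S se0.
have hsup : forall x y z, restr e S x y z -> (y \in S) && (z \in S).
  by move=> x y z /and4P[_ -> ->].
move: (restr e S) hdeg ps hsup => {}e hdeg ps hsup {ce0 se0}se ce.
have [s1 s2] := se.
pose E p q := has (fun a => e a p q) s.
have symE : symmetric E by move=> p q; apply: eq_has => a; rewrite s2.
have Esh p q : E p q -> shadow e p q.
  by case/hasP=> a _ h; apply/existsP; exists a; rewrite s2 s1.
have disj p q : \sum_(a <- s) e a p q <= E p q.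
  rewrite /E; elim: s ps {s4 sS symE Esh E} => [|a s IH] /=.
    by rewrite big_nil.
  case/andP=> /allP ha /IH{}IH; rewrite big_cons.
  case h : (e a p q) => //=; rewrite big1_seq // => b /= bs.
  case h' : (e b p q) => //; have /existsP[w hw] := ha b bs.
  by exfalso; apply: (ce p q a b w _ _ hw); rewrite s2 s1.
have [|f hf] := @furedi_stability T E 4 S symE.
  move=> u u6 uS; apply/negP => pu.
  case: u u6 uS pu => // p u [u5] /= /andP[_ uS] /andP[/allP hp pu].
  (* [g q] indexes the first link containing the edge pq. Covered vertices get different indices, so
     the five neighbours of [p] would need five links. *)
  pose g q := find (fun a => e a p q) s.
  have gP q : q \in u -> e (nth p s (g q)) p q by move/hp; apply: nth_find.
  have : uniq [seq g q | q <- u].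
    have gN q q' : q \in u -> shadow e q q' -> q' \in u -> g q != g q'.
      move=> qu /existsP[w hw] q'u; apply/eqP => gg.
      by apply: (ce _ _ _ _ _ (gP q qu) _ hw); rewrite gg; exact: gP.
    suff H v : {subset v <= u} -> pairwise E v -> uniq [seq g q | q <- v] by exact: H.
    elim: v => //= q v IH hsub /andP[/allP hq hv].
    rewrite IH // ?andbT; last by move=> z zv; apply: hsub; rewrite inE zv orbT.
    apply/mapP => -[q' q'v /eqP]; apply/negP; apply: gN.
    - by apply: hsub; rewrite mem_head.
    - exact/Esh/hq.
    - by apply: hsub; rewrite inE q'v orbT.
  move=> ug; have := uniq_leq_size (s2 := iota 0 4) ug.
  rewrite size_map u5 size_iota => h; suff : 5 <= 4 by [].
  apply: h => i /mapP[q qu ->]; rewrite mem_iota /= add0n -s4 -has_find.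
  exact: hp.
(* Four disjoint links of density at least 4/19 fill 16/19 of the ordered pairs, above the Turán
   bound 4/5 for K_6-free graphs. *)
have : 4 * (4 * #|S| ^ 2) <= 19 * \sum_(u in S) \sum_(v in S) E u v.
  have -> : 4 * (4 * #|S| ^ 2) = \sum_(a <- s) 4 * #|S| ^ 2.
    by rewrite big_const_seq count_predT s4 iter_addn_0 mulnC.
  apply: (@leq_trans (\sum_(a <- s) 19 * deg e a)).
    rewrite big_seq [X in _ <= X]big_seq; apply: leq_sum => a as_.
    by apply: hdeg; move/allP: sS => /(_ a as_).
  rewrite -big_distrr leq_mul2l /=.
  apply: (@leq_trans (\sum_(a <- s) \sum_(u in S) \sum_(v in S) e a u v)).
    apply: leq_sum => a _; rewrite /deg [X in _ <= X]big_mkcond; apply: leq_sum => u _.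
    have [uS|uS] := boolP (u \in S); last first.
      by rewrite /codeg big1 // => v _; case h: e => //; case/andP: (hsup _ _ _ h); rewrite (negbTE uS).
    rewrite [X in _ <= X]big_mkcond; apply: leq_sum => v _.
    by case: ifP => // vS; case h: e => //; case/andP: (hsup _ _ _ h); rewrite vS.
  rewrite exchange_big; apply: leq_sum => u _.
  by rewrite exchange_big; apply: leq_sum => v _.
have : \sum_(u in S) \sum_(v in S) E u v <=
   \sum_(u in S) \sum_(v in S) (E u v + (E u v && (f u == f v))).
  by do 2![apply: leq_sum => ? _]; apply: leq_addr.
have : 0 < #|S|.
  by case: s s4 sS {ps E symE Esh disj f hf} => // a s _ /andP[aS _]; apply/card_gt0P; exists a.
by move: hf; rewrite -sqrn_gt0; lia.
Qed.

Lemma codeg_le e S : (forall x y z, e x y z -> z \in S) ->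
  forall x y, codeg e x y <= #|S| * shadow e x y.
Proof.
move=> hS x y; have [_|/existsPn h] := boolP (shadow e x y); last first.
  by rewrite muln0 /codeg big1 // => z _; rewrite (negbTE (h z)).
rewrite muln1 -sum1_card [X in _ <= X]big_mkcond; apply: leq_sum => z _.
by case h: (e x y z) => //; rewrite (hS _ _ _ h).
Qed.

(* The codegree neighbourhoods of the three pairs of a hyperedge are disjoint;
   sum their sizes over all hyperedges and use Cauchy-Schwarz. *)
Lemma size3_le_shadow e S : triple_sym e -> cancellative e ->
  (forall x y z, e x y z -> z \in S) ->
  3 * size3 e <= #|S| * \sum_x \sum_y shadow e x y.
Proof.
move=> se ce hS; have [s1 s2] := se.
set P := \sum_x \sum_y _; pose N := size3 e.
pose Q := \sum_x \sum_y codeg e x y * codeg e x y.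
have hQ : 3 * Q <= #|S| * N.
  rewrite -triple_sum_pairs // mulnC /N /size3 /deg /codeg.
  rewrite big_distrl; apply: leq_sum => x _; rewrite big_distrl.
  apply: leq_sum => y _; rewrite big_distrl; apply: leq_sum => z _ /=.
  case exyz: (e x y z) => //; rewrite !mul1n -!big_split -sum1_card.
  rewrite [X in _ <= X]big_mkcond; apply: leq_sum => w _ /=.
  have [exzy eyzx] := triple_sym_perm se exyz.
  have h1 : e x y w -> e x z w -> False.
    move=> /(triple_sym_perm se)[h _] /(triple_sym_perm se)[h' _].
    exact: ce h h' eyzx.
  have h2 : e x y w -> e y z w -> False.
    move=> /(triple_sym_perm se)[_ h] /(triple_sym_perm se)[h' _].
    exact: ce h h' exzy.
  have h3 : e x z w -> e y z w -> False.
    move=> /(triple_sym_perm se)[_ h] /(triple_sym_perm se)[_ h'].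
    exact: ce h h' exyz.
  case exyw: (e x y w); case exzw: (e x z w); case eyzw: (e y z w);
    rewrite ?(hS _ _ _ exyw) ?(hS _ _ _ exzw) ?(hS _ _ _ eyzw) //;
    exfalso; [exact: h1|exact: h1|exact: h2|exact: h3].
(* Cauchy-Schwarz without division: sum 2N(P codeg) <= N^2 + (P codeg)^2 over the P ordered pairs of
   the shadow. *)
have hCS : P * N ^ 2 <= P ^ 2 * Q.
  suff : 2 * (N * (P * N)) <= N ^ 2 * P + P ^ 2 * Q by rewrite !expnS !expn0; lia.
  rewrite {2}/N {3}/P /Q /size3 /deg !big_distrr -big_split; apply: leq_sum => x _.
  rewrite !big_distrr -big_split; apply: leq_sum => y _ /=.
  have [_|hxy] := boolP (shadow e x y).
    have [+ _] := nat_Cauchy N (P * codeg e x y).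
    by rewrite expnMn muln1 mulnn.
  by have := codeg_le hS x y; rewrite (negbTE hxy) muln0 leqn0 => /eqP->; rewrite !muln0.
rewrite -/N; have [->|N0] := posnP N; first by rewrite muln0.
have P0 : 0 < P.
  have : N <= #|S| * P.
    rewrite /P big_distrr; apply: leq_sum => x _; rewrite big_distrr.
    by apply: leq_sum => y _; apply: codeg_le.
  by rewrite lt0n; apply: contraTneq => ->; rewrite muln0 -ltnNge.
rewrite -(leq_pmul2l N0).
have : N ^ 2 <= P * Q by rewrite -(leq_pmul2l P0) mulnA mulnn.
have := leq_mul (leqnn P) hQ; rewrite -mulnn; lia.
Qed.

(** * Colourings and non-crossing triples *)

Definition noncrossing e (f : T -> 'I_3) :=
  size3 (fun x y z => e x y z && ~~ uniq [:: f x; f y; f z]).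

(** With P shadow pairs, M of them monochromatic, [furedi_stability] for r = 2 gives 3(P + M) <=
    2|S|^2. Multiply by |S|: 3|S|M bounds the non-crossing triples and |S|P is at least 3
    [size3 e]. *)
Lemma noncrossing_le e S : triple_sym e -> cancellative e ->
  (forall x y z, e x y z -> z \in S) ->
  (forall s : seq T, size s = 4 -> all (mem S) s -> ~~ pairwise (shadow e) s) ->
  exists f, noncrossing e f + 9 * size3 e <= 2 * #|S| ^ 3.
Proof.
move=> se ce hS K4; have [s1 s2] := se.
have [f hf] := furedi_stability (shadow_sym se) K4; exists f.
have hSh x y : shadow e x y -> (x \in S) && (y \in S).
  case/existsP=> z h; have [h1 h2] := triple_sym_perm se h.
  by rewrite (hS _ _ _ h1) (hS _ _ _ h2).
pose m x y : nat := shadow e x y && (f x == f y).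
have : noncrossing e f <= 3 * (#|S| * \sum_x \sum_y m x y).
  apply: (@leq_trans (3 * \sum_x \sum_y codeg e x y * (f x == f y))).
    rewrite -triple_sum_pairs //; do 3![apply: leq_sum => ? _] => /=.
    by rewrite !inE; case: (e _ _ _); do 3!case: (_ == _).
  rewrite leq_mul2l /= big_distrr; apply: leq_sum => x _.
  rewrite big_distrr; apply: leq_sum => y _ /=.
  by apply: (leq_trans (leq_mul (codeg_le hS x y) (leqnn _))); rewrite -mulnA mulnb.
have := size3_le_shadow se ce hS.
move: hf.
have -> : \sum_(u in S) \sum_(v in S) (shadow e u v + (shadow e u v && (f u == f v)))
  = \sum_x \sum_y shadow e x y + \sum_x \sum_y m x y.
  rewrite -big_split [LHS]big_mkcond; apply: eq_bigr => x _; rewrite -big_split.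
  have [xS|xS] := boolP (x \in S); last first.
    rewrite big1 // => y _; rewrite /m; case h: (shadow e x y) => //.
    by case/andP: (hSh _ _ h); rewrite (negbTE xS).
  rewrite big_mkcond; apply: eq_bigr => y _; rewrite /m.
  have [//|yS] := boolP (y \in S); case h: (shadow e x y) => //.
  by case/andP: (hSh _ _ h); rewrite (negbTE yS).
move=> /(leq_mul (leqnn #|S|)); rewrite !expnS !expn0; lia.
Qed.

(** Every deleted triple may be non-crossing. Adding the deletion bound to twice [noncrossing_le]
    cancels |S|^3 and leaves 19 - 1 = 18 copies of [size3 e]. *)
Lemma cancellative_stability e : triple_sym e -> cancellative e ->
  exists f, noncrossing e f + 18 * size3 e <= 4 * #|T| ^ 3 + 12 * #|T| ^ 2.
Proof.
move=> se ce; have [S [hdeg hdel]] := delete_low_degree se.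
have [] := noncrossing_le (restr_sym S se) (restr_cancellative (S := S) ce) _
  (shadow_K4_free se ce hdeg); first by move=> x y z /and4P[].
move=> f hf; exists f.
have : noncrossing e f + size3 (restr e S) <= noncrossing (restr e S) f + size3 e.
  rewrite /noncrossing /size3 /deg /codeg.
  rewrite -!big_split; apply: leq_sum => x _; rewrite -!big_split.
  apply: leq_sum => y _; rewrite -!big_split; apply: leq_sum => z _ /=.
  rewrite /restr; case: (_ \in S); case: (_ \in S); case: (_ \in S);
    by case: (e x y z); case: (~~ _).
lia.
Qed.

(** * Discarding light pairs *)

Definition heavy_part k e x y z :=
  [&& e x y z, k < codeg e x y, k < codeg e x z & k < codeg e y z].

Lemma codegC e : triple_sym e -> forall x y, codeg e x y = codeg e y x.
Proof. by case=> s1 _ x y; apply: eq_bigr => z _; rewrite s1. Qed.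

Lemma heavy_part_sym k e : triple_sym e -> triple_sym (heavy_part k e).
Proof.
move=> se; have [s1 s2] := se; split=> x y z; rewrite /heavy_part.
  by rewrite s1 (codegC se x y); congr [&& _, _ & _]; apply: andbC.
by rewrite s2 (codegC se y z); congr (_ && _); apply: andbCA.
Qed.

(** Light pairs lie in at most 3k|T|^2 ordered triples. Each discarded triple costs 1 as
    non-crossing and 18 in [size3], whence 57 = 3 * 19. *)
Lemma heavy_part_stability k e : triple_sym e -> cancellative (heavy_part k e) ->
  exists f, noncrossing e f + 18 * size3 e <=
    4 * #|T| ^ 3 + (12 + 57 * k) * #|T| ^ 2.
Proof.
move=> se ch; have [f hf] := cancellative_stability (heavy_part_sym k se) ch.
exists f; pose l x y : nat := codeg e x y <= k.
pose L := \sum_x \sum_y \sum_z e x y z * (l x y + l x z + l y z).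
have hL : L <= 3 * (k * #|T| ^ 2).
  rewrite /L triple_sum_pairs // leq_mul2l /=.
  rewrite -mulnn mulnCA -sum_nat_const; apply: leq_sum => x _.
  rewrite mulnC -sum_nat_const; apply: leq_sum => y _.
  by rewrite /l; case: (leqP (codeg e x y) k) => h; rewrite ?muln1 ?muln0.
have h1 : size3 e <= size3 (heavy_part k e) + L.
  rewrite /L /size3 /deg /codeg.
  rewrite -!big_split; apply: leq_sum => x _; rewrite -!big_split.
  apply: leq_sum => y _; rewrite -!big_split; apply: leq_sum => z _ /=.
  by rewrite /heavy_part /l; case: (e x y z) => //; do 3!case: ltnP => _.
have h2 : noncrossing e f <= noncrossing (heavy_part k e) f + L.
  rewrite /L /noncrossing /size3 /deg /codeg.
  rewrite -!big_split; apply: leq_sum => x _; rewrite -!big_split.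
  apply: leq_sum => y _; rewrite -!big_split; apply: leq_sum => z _ /=.
  rewrite /heavy_part /l; case: (e x y z) => //; case: (~~ _) => //=.
  by case: (ltnP k (codeg e x y)); case: (ltnP k (codeg e x z));
    case: (ltnP k (codeg e y z)).
lia.
Qed.
End Triples.

(** * Transfer to sets of hyperedges *)

Section Hypergraphs.
Variable T : finType.
Implicit Types (H : {set {set T}}) (x y z : T).

(** In a 3-graph a triple with a repeated vertex fails this, its set being too small. *)
Definition triple_in H x y z := [set x; y; z] \in H.

Lemma triple_in_sym H : triple_sym (triple_in H).
Proof.
split=> x y z; rewrite /triple_in; congr (_ \in H); apply/setP => v; rewrite !inE.
  by rewrite (orbC (v == x)).
by rewrite orbAC.
Qed.

Lemma card_set3 x y z : (#|[set x; y; z]| == 3) = uniq [:: x; y; z].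
Proof.
have -> : #|[set x; y; z]| = #|[:: x; y; z]|.
  by apply: eq_card => v; rewrite !inE -orbA.
exact/eqP/card_uniqP.
Qed.

(** Choosing the vertices in turn gives the factors 3, 2, 1 of [size3_card]. *)
Lemma set3_eq (A : {set T}) x y z : #|A| = 3 ->
  ([set x; y; z] == A) = [&& x \in A, y \in A :\ x & z \in A :\ x :\ y].
Proof.
move=> A3; apply/idP/idP => [/eqP eA|].
  have := card_set3 x y z; rewrite eA A3 eqxx => /esym /=.
  rewrite -eA !inE !eqxx !orbT !andbT !(eq_sym x) !(eq_sym y z).
  by case/andP; rewrite negb_or => /andP[-> ->] ->.
rewrite !inE => /and5P[xA /andP[yx yA] zy zx zA].
rewrite eqEcard A3 !subUset !sub1set xA yA zA /=.
have /eqP-> // : #|[set x; y; z]| == 3.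
by rewrite card_set3 /= !inE negb_or !andbT eq_sym yx eq_sym zx eq_sym zy.
Qed.

Lemma size3_card H : three_graph H -> size3 (triple_in H) = 6 * #|H|.
Proof.
move=> h3.
have sumH (B : {set T}) : (B \in H) = \sum_(A in H) (B == A) :> nat.
  have [BH|BH] := boolP (B \in H).
    by rewrite (bigD1 B) //= eqxx big1 // => A /andP[_]; rewrite eq_sym => /negbTE->.
  by rewrite big1 // => A AH; case: eqP => // eBA; rewrite eBA AH in BH.
transitivity (\sum_(A in H) \sum_x \sum_y \sum_z ([set x; y; z] == A)).
  rewrite [RHS]exchange_big; apply: eq_bigr => x _.
  rewrite [RHS]exchange_big; apply: eq_bigr => y _.
  by rewrite [RHS]exchange_big; apply: eq_bigr => z _; apply: sumH.
rewrite mulnC -sum_nat_const; apply: eq_bigr => A /h3 A3.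
transitivity (\sum_(x in A) 2); last by rewrite sum_nat_const A3.
rewrite [RHS]big_mkcond; apply: eq_bigr => x _.
have [xA|xA] := ifP; last by do 2![rewrite big1 // => ? _]; rewrite set3_eq // xA.
have c2 : #|A :\ x| = 2 by have := cardsD1 x A; rewrite xA A3 => -[].
transitivity (\sum_(y in A :\ x) 1); last by rewrite sum1_card.
rewrite [RHS]big_mkcond; apply: eq_bigr => y _.
have [yA|yA] := ifP; last by rewrite big1 // => ? _; rewrite set3_eq // xA yA.
have c1 : #|A :\ x :\ y| = 1 by have := cardsD1 y (A :\ x); rewrite yA c2 => -[].
rewrite -c1 -sum1_card [RHS]big_mkcond; apply: eq_bigr => z _.
by rewrite set3_eq // xA yA; case: (_ \in _).
Qed.

(** Let p, q, x, y play 1, 2, 3, 4. The heavy pair xy has at least t + 3 third vertices; at most two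
    are p or q, so t + 1 remain for the vertices from 5 on. *)
Lemma F5_free_cancellative t H : three_graph H -> is_free (F5 t) H ->
  cancellative (heavy_part t.+2 (triple_in H)).
Proof.
move=> h3 hfree p q x y w /and4P[pqx _ _ _] /and4P[pqy _ _ _] /and4P[xyw hxy _ _].
have udist a b c : triple_in H a b c -> uniq [:: a; b; c].
  by move/h3/eqP; rewrite card_set3.
apply: hfree; pose K := [set k | triple_in H x y k] :\: [set p; q].
have hK : t.+1 <= #|K|.
  have : codeg (triple_in H) x y = #|[set k | triple_in H x y k]|.
    by rewrite -sum1_card [RHS]big_mkcond; apply: eq_bigr => k _; rewrite inE; case: ifP.
  have := cardsID [set p; q] [set k | triple_in H x y k].
  have : #|[set k | triple_in H x y k] :&: [set p; q]| <= 2.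
    by apply: (leq_trans (subset_leq_card (subsetIr _ _))); rewrite cards2; case: (_ != _).
  rewrite -/K; move: hxy; lia.
pose l := [:: p, q, x, y & enum K].
have sl : 5 + t <= size l by rewrite /= -cardE; lia.
have ul : uniq l.
  have := udist _ _ _ pqx; have := udist _ _ _ pqy; have := udist _ _ _ xyw.
  rewrite /= !inE !negb_or !mem_enum enum_uniq !inE !eqxx /= !orbT /= !andbT.
  case/andP=> /andP[-> _] _; case/andP=> /andP[-> ->] ->; case/andP=> /andP[_ ->] -> /=.
  (* [x] and [y] are not in [K], since a hyperedge has no repeated vertex. *)
  apply/andP; split; apply/negP => /andP[_ /udist]; rewrite /= !inE !eqxx ?orbT ?andbF //.
(* By [sl] the default [p] of [nth] is never reached. *)
exists (fun i : 'I_(5 + t) => nth p l i); split=> [i j|e].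
  move/eqP; rewrite nth_uniq ?(leq_trans (ltn_ord _) sl) // => /eqP ij.
  exact: val_inj.
have v i : i < 5 -> nth p l (@inord (4 + t) i) = nth p l i.
  by move=> i5; rewrite inordK // (leq_trans i5).
rewrite !inE -orbA => /or3P[/eqP->|/eqP->|/imsetP[k hk ->]].
- by rewrite !imsetU !imset_set1 !v.
- by rewrite !imsetU !imset_set1 !v.
rewrite !imsetU !imset_set1 !v //=.
have : nth p l k \in K.
  rewrite -mem_enum; move: hk; rewrite inE => hk.
  rewrite /l -[[:: p, q, x, y & enum K]]/([:: p; q; x; y] ++ enum K) nth_cat /=.
  rewrite ltnNge hk /=; apply: mem_nth.
  by have := ltn_ord k; have := sl; rewrite /=; lia.
by rewrite !inE => /andP[].
Qed.

Definition fibre (f : T -> 'I_3) (i : 'I_3) : {set T} := [set x | f x == i].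

Lemma fibre_tripartition f : tripartition (fibre f).
Proof.
split=> [i j ij|]; last first.
  by apply/setP => x; rewrite inE; apply/bigcupP; exists (f x); rewrite ?inE.
rewrite -setI_eq0; apply/eqP/setP => x; rewrite !inE.
by case: eqP => // ->; rewrite (negbTE ij).
Qed.

(** An injective colouring of three vertices by three colours is onto, so each fibre meets the
    triple exactly once. *)
Lemma rainbow_Kpart f x y z : uniq [:: x; y; z] -> uniq [:: f x; f y; f z] ->
  [set x; y; z] \in Kpart (fibre f).
Proof.
move=> uxyz uf; rewrite inE card_set3 uxyz; apply/forallP => i /=.
have finj : {in [set x; y; z] &, injective f}.
  move: uf; rewrite /= !inE negb_or !andbT => /andP[/andP[xy xz] yz] u v.
  rewrite !inE -!orbA => /or3P[]/eqP-> /or3P[]/eqP-> // /eqP;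
    by rewrite ?(negbTE xy) ?(negbTE xz) ?(negbTE yz) // eq_sym
         ?(negbTE xy) ?(negbTE xz) ?(negbTE yz).
have /setP/(_ i) : f @: [set x; y; z] = [set: 'I_3].
  apply/eqP; rewrite eqEcard subsetT cardsT card_ord card_in_imset //.
  by move: uxyz; rewrite -card_set3 => /eqP->.
rewrite inE => /imsetP[u hu iu]; apply/cards1P; exists u.
apply/setP => v; rewrite in_setI in_set1 [v \in fibre f i]in_set iu.
by apply/andP/eqP => [[hv /eqP/finj ->]|->].
Qed.

Lemma card_noncrossing H f : three_graph H ->
  6 * #|H :\: Hpart H (fibre f)| <= noncrossing (triple_in H) f.
Proof.
move=> h3; rewrite -size3_card; last by move=> A /setDP[/h3].
apply: leq_size3 => x y z; rewrite /triple_in in_setD in_setI.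
case hA: (_ \in H); rewrite ?andbF //= andbT.
have uxyz : uniq [:: x; y; z] by rewrite -card_set3; apply/eqP/h3.
have [hu|/negPf /= ->] := boolP (uniq [:: f x; f y; f z]); last exact: leq_b1.
by rewrite rainbow_Kpart.
Qed.

Lemma max_tripartition_le H V W : max_tripartition H V -> tripartition W ->
  #|H :\: Hpart H V| <= #|H :\: Hpart H W|.
Proof.
move=> [_ maxV] /maxV hW.
have c U : #|Hpart H U| + #|H :\: Hpart H U| = #|H|.
  by have := cardsID (Hpart H U) H; rewrite [H :&: _](setIidPr _) // subsetIl.
have := c V; have := c W; lia.
Qed.

(** By maximality V misses no more hyperedges than the colour classes of the stability colouring. *)
Lemma F5_free_noncrossing t H V : three_graph H -> is_free (F5 t) H ->
  max_tripartition H V ->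
  6 * #|H :\: Hpart H V| + 108 * #|H| <=
    4 * #|T| ^ 3 + (12 + 57 * t.+2) * #|T| ^ 2.
Proof.
move=> h3 hfree maxV.
have [f] := heavy_part_stability (triple_in_sym H) (F5_free_cancellative h3 hfree).
have := card_noncrossing f h3.
have := max_tripartition_le maxV (fibre_tripartition f).
rewrite size3_card //; lia.
Qed.

End Hypergraphs.

(** * Choice of the constants *)

Import Order.TTheory GRing.Theory Num.Theory.
Local Open Scope ring_scope.

Theorem theorem2p5 (R : realType) (t : nat) (eps : R) (heps : 0 < eps) :
  exists (delta : R) (N : nat),
    [/\ 0 < delta, delta < eps, (0 < N)%N &
      forall n : nat, (N < n)%N ->
      forall H : {set {set 'I_n}},
        three_graph H ->
        is_free (F5 t) H ->
        (1 / 27%:R - delta) * n%:R ^+ 3 <= #|H|%:R ->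
      forall V : 'I_3 -> {set 'I_n},
        max_tripartition H V ->
        #|H :\: Hpart H V|%:R <= eps * n%:R ^+ 3].
Proof.
pose c := (12 + 57 * t.+2)%N.
(* As 108/27 = 4, the cubic terms cancel up to 108 delta n^3 = 3 eps n^3; the choice of N makes c
   n^2 at most eps n^3, and 3 + 1 <= 6. *)
exists (eps / 36%:R), (Num.truncn (c%:R / eps)).+1.
split=> //; [lra | lra |].
move=> n hn H h3 hfree hH V maxV.
have cn : c%:R <= eps * n%:R.
  rewrite mulrC -ler_pdivrMr //; apply: ltW; apply: lt_trans (truncnS_gt _) _.
  by rewrite ltr_nat.
have cn3 : c%:R * n%:R ^+ 2 <= eps * n%:R ^+ 3.
  by rewrite (exprS _ 2) mulrA; apply: ler_wpM2r => //; apply: exprn_ge0.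
have : 6%:R * #|H :\: Hpart H V|%:R + 108%:R * #|H|%:R
    <= 4%:R * n%:R ^+ 3 + c%:R * n%:R ^+ 2 :> R.
  rewrite -!natrX -!natrM -!natrD ler_nat.
  by have := F5_free_noncrossing h3 hfree maxV; rewrite card_ord.
have : 0 <= eps * n%:R ^+ 3 by rewrite mulr_ge0 ?exprn_ge0 // ltW.
by rewrite mulrBl in hH; lra.
Qed.
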